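(* Let $A=(a_1\ a_2\ a_3)$ be a $1\times 3$ matrix of pairwise distinct positive integers, and let $M$ be a minimal Markov basis for $A$. Then $M$ is distance reducing if and only if $M$ reduces the distance of the circuits of $A$.
   Context: For $z\in\mathbb Z^n$, $z^+,z^-\in\mathbb N^n$ denote the unique vectors with disjoint supports and $z=z^+-z^-$; $\|\cdot\|$ is the $1$-norm. The toric ideal of $A$ is $I_A=\langle x^{u^+}-x^{u^-}: u\in\ker(A)\rangle$, $\ker(A)\subseteq\mathbb Z^n$. A Markov basis is a set $B\subseteq\ker(A)$ such that $\{x^{u^+}-x^{u^-}:u\in B\}$ generates $I_A$; it is minimal if no proper subset is a Markov basis. For nonzero $z\in\ker(A)$ and $u\in\ker(A)$, $u$ reduces the distance of $z$ if there exist $(p,q)\in\{(z^+,z^-),(z^-,z^+)\}$ and $\varepsilon\in\{1,-1\}$ with $p+\varepsilon u\in\mathbb N^n$ and $\|p+\varepsilon u-q\|<\|z\|$. A set $B$ reduces the distance of $Z\subseteq\ker(A)$ if every nonzero $z\in Z$ has its distance reduced by some $u\in B$; $B$ is distance reducing if it reduces the distance of $\ker(A)$. A circuit of $A$ is a nonzero element of $\ker(A)$ whose support has exactly two elements. *)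

(* Defs.v *)
From HB Require Import structures.
From mathcomp Require Import all_boot all_order all_algebra.
From mathcomp Require Import mpoly.
Set Implicit Arguments. Unset Strict Implicit. Unset Printing Implicit Defensive.
Import Order.TTheory GRing.Theory Num.Theory.
Local Open Scope ring_scope.

Definition in_ker (d n : nat) (A : 'M[int]_(d, n)) (z : 'cV[int]_n) : Prop :=
  A *m z = 0.

Definition vpos (n : nat) (z : 'cV[int]_n) : 'cV[int]_n :=
  \col_i Num.max (z i 0) 0.
Definition vneg (n : nat) (z : 'cV[int]_n) : 'cV[int]_n :=
  \col_i Num.max (- z i 0) 0.

Definition is_nat_vec (n : nat) (v : 'cV[int]_n) : Prop :=
  forall i, 0 <= v i 0.

Definition norm1 (n : nat) (v : 'cV[int]_n) : int := \sum_i `|v i 0|.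

(* monomial x^v for v in N^n (negative entries are truncated, never used) *)
Definition monom (K : fieldType) (n : nat) (v : 'cV[int]_n) : {mpoly K[n]} :=
  'X_[ [multinom absz (v i ord0) | i < n] ].
Arguments monom K {_}.

Definition binom (K : fieldType) (n : nat) (u : 'cV[int]_n) : {mpoly K[n]} :=
  monom K (vpos u) - monom K (vneg u).
Arguments binom K {_}.

Definition in_ideal (K : fieldType) (n : nat) (S : {mpoly K[n]} -> Prop)
    (p : {mpoly K[n]}) : Prop :=
  exists s : seq ({mpoly K[n]} * {mpoly K[n]}),
    (forall c, c \in s -> S c.2) /\ p = \sum_(c <- s) c.1 * c.2.
Arguments in_ideal K {_}.

Definition binoms (K : fieldType) (n : nat) (B : 'cV[int]_n -> Prop)
    (p : {mpoly K[n]}) : Prop :=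
  exists2 u, B u & p = binom K u.
Arguments binoms K {_}.

Definition toric_ideal (K : fieldType) (d n : nat) (A : 'M[int]_(d, n))
    (p : {mpoly K[n]}) : Prop :=
  in_ideal K (binoms K (in_ker A)) p.
Arguments toric_ideal K {_} {_}.

Definition markov_basis (K : fieldType) (d n : nat) (A : 'M[int]_(d, n))
    (B : 'cV[int]_n -> Prop) : Prop :=
  (forall u, B u -> in_ker A u) /\
  (forall p, in_ideal K (binoms K B) p <-> toric_ideal K A p).
Arguments markov_basis K {_} {_}.

Definition minimal_markov_basis (K : fieldType) (d n : nat)
    (A : 'M[int]_(d, n)) (B : 'cV[int]_n -> Prop) : Prop :=
  markov_basis K A B /\
  forall B' : 'cV[int]_n -> Prop,
    (forall u, B' u -> B u) -> (exists2 u, B u & ~ B' u) ->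
    ~ markov_basis K A B'.
Arguments minimal_markov_basis K {_} {_}.

Definition reduces_distance_of (n : nat) (u z : 'cV[int]_n) : Prop :=
  exists (pq : 'cV[int]_n * 'cV[int]_n) (eps : int),
    (pq = (vpos z, vneg z) \/ pq = (vneg z, vpos z)) /\
    (eps = 1 \/ eps = -1) /\
    is_nat_vec (pq.1 + eps *: u) /\
    norm1 (pq.1 + eps *: u - pq.2) < norm1 z.

Definition reduces_distance_set (n : nat) (B Z : 'cV[int]_n -> Prop) : Prop :=
  forall z, Z z -> z != 0 -> exists2 u, B u & reduces_distance_of u z.

Definition distance_reducing (d n : nat) (A : 'M[int]_(d, n))
    (B : 'cV[int]_n -> Prop) : Prop :=
  reduces_distance_set B (in_ker A).

Definition circuit (d n : nat) (A : 'M[int]_(d, n)) (z : 'cV[int]_n) : Prop :=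
  in_ker A z /\ z != 0 /\ #|[set i | z i 0 != 0]| = 2%N.

(* Main.v *)
(** Let a_i be the smallest weight and {j, k} the other two indices. Two points
    of a fiber are linked by moves of M, so the pure power end of any kernel
    vector with one negative coordinate l admits a move of M whose only negative
    coordinate is l. For l = i such a move shortens every vector it applies to,
    because a_i is the smallest weight.

    A move reducing the distance of the circuit (0, a_k, -a_j) must be, up to
    sign and to exchanging j and k, of the form w = (s, -t, r) with s, r >= 0 and
    s < t + r. Minimality of M forces t to be the least multiplicity with t a_j in
    the semigroup generated by a_i and a_k (or s = 0, and the same holds with j and
    k exchanged): otherwise w is redundant in M. With such a w at hand, every
    kernel vector is reduced by w, by a move on the i-ray, or by a move on the
    k-ray. *)

Require Import Defs.
From HB Require Import structures.
From mathcomp Require Import all_boot all_order all_algebra.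
From mathcomp Require Import mpoly.
From mathcomp Require Import zify.
From Stdlib Require Import Classical ClassicalEpsilon.
Set Implicit Arguments.
Unset Strict Implicit.
Unset Printing Implicit Defensive.
Import Order.TTheory GRing.Theory Num.Theory.
Local Open Scope ring_scope.

(** * Coordinates of integer vectors *)

Lemma colD n (v w : 'cV[int]_n) i : (v + w) i 0 = v i 0 + w i 0.
Proof. by rewrite mxE. Qed.

Lemma colN n (v : 'cV[int]_n) i : (- v) i 0 = - v i 0.
Proof. by rewrite mxE. Qed.

Lemma vposE n (v : 'cV[int]_n) i : vpos v i 0 = Num.max (v i 0) 0.
Proof. by rewrite mxE. Qed.

Lemma vnegE n (v : 'cV[int]_n) i : vneg v i 0 = Num.max (- v i 0) 0.
Proof. by rewrite mxE. Qed.

Definition colE := (colD, colN, vposE, vnegE).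

Lemma colP n (v w : 'cV[int]_n) : (forall i, v i 0 = w i 0) -> v = w.
Proof. by move=> vw; apply/matrixP => i j; rewrite ord1. Qed.

Lemma vpos_nat n (z : 'cV[int]_n) : is_nat_vec (vpos z).
Proof. by move=> i; rewrite !colE; lia. Qed.

Lemma vneg_nat n (z : 'cV[int]_n) : is_nat_vec (vneg z).
Proof. by move=> i; rewrite !colE; lia. Qed.

#[local] Hint Resolve vpos_nat vneg_nat : core.

(** * Ideals generated by binomials *)

Section Ideals.
Variables (K : fieldType) (n : nat).
Implicit Types (S : {mpoly K[n]} -> Prop) (p q : {mpoly K[n]}).

Lemma in_ideal0 S : in_ideal K S 0.
Proof. by exists [::]; rewrite big_nil. Qed.

Lemma in_idealD S p q :
  in_ideal K S p -> in_ideal K S q -> in_ideal K S (p + q).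
Proof.
move=> [s [Ss ->]] [t [St ->]]; exists (s ++ t); rewrite big_cat; split=> // c.
by rewrite mem_cat => /orP[/Ss|/St].
Qed.

Lemma in_idealM S q p : in_ideal K S p -> in_ideal K S (q * p).
Proof.
move=> [s [Ss ->]]; exists [seq (q * c.1, c.2) | c <- s]; split.
  by move=> _ /mapP[c /Ss Sc ->].
by rewrite big_map mulr_sumr; apply: eq_bigr => c _; rewrite mulrA.
Qed.

Lemma in_idealN S p : in_ideal K S p -> in_ideal K S (- p).
Proof. by rewrite -mulN1r; exact: in_idealM. Qed.

Lemma in_ideal_gen S p : S p -> in_ideal K S p.
Proof.
move=> Sp; exists [:: (1, p)]; rewrite big_seq1 mul1r; split=> // c.
by rewrite inE => /eqP->.
Qed.

Lemma in_ideal_trans S S' p :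
  (forall q, S q -> in_ideal K S' q) -> in_ideal K S p -> in_ideal K S' p.
Proof.
move=> SS' [s [Ss ->]]; rewrite big_seq_cond.
apply: (big_ind (in_ideal K S')) => [||c /andP[/Ss Sc _]].
- exact: in_ideal0.
- exact: in_idealD.
- exact/in_idealM/SS'.
Qed.

Lemma in_ideal_binoms_sub (B B' : 'cV[int]_n -> Prop) p :
  (forall u, B u -> B' u) ->
  in_ideal K (binoms K B) p -> in_ideal K (binoms K B') p.
Proof.
move=> BB'; apply: in_ideal_trans => q [u Bu ->].
by apply: in_ideal_gen; exists u => //; apply: BB'.
Qed.

Lemma monomD (v w : 'cV[int]_n) : is_nat_vec v -> is_nat_vec w ->
  monom K (v + w) = monom K v * monom K w.
Proof.
move=> v0 w0; rewrite /monom -mpolyXD; congr 'X_[_]; apply/mnmP => i.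
rewrite mnmDE !mnmE (_ : ord0 = 0) // colD.
by move: (v0 i) (w0 i); lia.
Qed.

Lemma is_nat_vecD (v w : 'cV[int]_n) :
  is_nat_vec v -> is_nat_vec w -> is_nat_vec (v + w).
Proof. by move=> v0 w0 i; rewrite colD addr_ge0. Qed.

Lemma vpos_sub_vneg (z : 'cV[int]_n) : vpos z - vneg z = z.
Proof. by apply: colP => i; rewrite !colE; lia. Qed.

Lemma vposN (z : 'cV[int]_n) : vpos (- z) = vneg z.
Proof. by apply: colP => i; rewrite !colE. Qed.

Lemma vnegN (z : 'cV[int]_n) : vneg (- z) = vpos z.
Proof. by apply: colP => i; rewrite !colE opprK. Qed.

Lemma binomN (u : 'cV[int]_n) : binom K (- u) = - binom K u.
Proof. by rewrite /binom vposN vnegN opprB. Qed.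

(** Nonnegativity of [m] and [m + u] makes [m] dominate [vneg u], so [m - vneg u] is the exponent of
    the cofactor. *)
Lemma monom_sub_binom (m u : 'cV[int]_n) :
  is_nat_vec m -> is_nat_vec (m + u) ->
  exists w, monom K (m + u) - monom K m = monom K w * binom K u.
Proof.
move=> m0 mu0; exists (m - vneg u).
have w0 : is_nat_vec (m - vneg u).
  by move=> i; move: (m0 i) (mu0 i); rewrite !colE; lia.
rewrite mulrBr -!monomD ?subrK //.
by rewrite addrAC -addrA vpos_sub_vneg.
Qed.

(* The sum of the coefficients over a finite union of classes is a linear form
   killed by every monomial multiple of a generating binomial. *)
Lemma binoms_ideal_invariant (B S : 'cV[int]_n -> Prop) (k : int) :
  (forall v, is_nat_vec v -> S v -> norm1 v < k) ->
  (forall u w, B u -> is_nat_vec w -> S (w + vpos u) <-> S (w + vneg u)) ->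
  forall m m', is_nat_vec m -> is_nat_vec m' ->
  in_ideal K (binoms K B) (monom K m - monom K m') -> S m -> S m'.
Proof.
move=> Sk SB m m' m0 m'0 [s [sB def_mm']].
pose vec (x : 'X_{1..n}) : 'cV[int]_n := \col_i (x i)%:Z.
pose mexp (v : 'cV[int]_n) := [multinom `|v i ord0|%N | i < n].
have vec0 x : is_nat_vec (vec x) by move=> i; rewrite mxE; lia.
have vecK v : is_nat_vec v -> vec (mexp v) = v.
  move=> v0; apply: colP => i; rewrite mxE mnmE (_ : ord0 = 0) //.
  by move: (v0 i); lia.
have mexpK x : mexp (vec x) = x by apply/mnmP => i; rewrite mnmE mxE.
pose T x : bool :=
  if excluded_middle_informative (S (vec x)) then true else false.
have TP x : reflect (S (vec x)) (T x).
  by rewrite /T; case: excluded_middle_informative => h; constructor.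
have Tk x : T x -> (mdeg x < `|k|)%N.
  move/TP/(Sk _ (vec0 x)).
  suff -> : norm1 (vec x) = (mdeg x)%:Z by lia.
  rewrite mdegE /norm1 -[RHS]natz natr_sum; apply: eq_bigr => i _.
  by rewrite mxE natz; lia.
(* By [Tk] the degree cutoff loses no monomial of [S], so on monomials [phi] is the indicator of
   [S]. *)
pose phi p : K := \sum_(x : 'X_{1..n < `|k|} | T x) p@_x.
have phiD : {morph phi : p q / p + q}.
  by move=> p q; rewrite /phi -big_split; apply: eq_bigr => x _; rewrite mcoeffD.
have phiZ c p : phi (c *: p) = c * phi p.
  by rewrite /phi mulr_sumr; apply: eq_bigr => x _; rewrite mcoeffZ.
have phi0 : phi 0 = 0 by rewrite /phi big1 // => x _; rewrite mcoeff0.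
have phiX x : phi 'X_[x] = (T x)%:R.
  rewrite /phi; have [Tx|nTx] := boolP (T x); last first.
    apply: big1 => y Ty; rewrite mcoeffX; case: eqP => // xy.
    by move: nTx; rewrite xy Ty.
  rewrite (bigD1 (BMultinom (Tk _ Tx))) //= mcoeffX eqxx big1 ?addr0 //.
  move=> y /andP[_]; rewrite mcoeffX bmeqP /= eq_sym.
  by case: eqP.
have phiB p q : phi (p - q) = phi p - phi q.
  by rewrite phiD -scaleN1r phiZ mulN1r.
have phi_gen q u : B u -> phi (q * binom K u) = 0.
  move=> Bu; rewrite [q]mpolyE mulr_suml.
  apply: (big_ind (fun p => phi p = 0)) => // [p p' hp hp'|x _].
    by rewrite phiD hp hp' addr0.
  rewrite -scalerAl phiZ.
  have -> : 'X_[x] = monom K (vec x) by rewrite /monom -/(mexp _) mexpK.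
  rewrite /binom mulrBr -!monomD //.
  rewrite phiB !phiX.
  suff -> : T (mexp (vec x + vpos u)) = T (mexp (vec x + vneg u)).
    by rewrite subrr mulr0.
  have wp0 := is_nat_vecD (vec0 x) (@vpos_nat _ u).
  have wn0 := is_nat_vecD (vec0 x) (@vneg_nat _ u).
  by apply/TP/TP; rewrite !vecK //; case: (SB _ _ Bu (vec0 x)).
have phi_mm' : phi (monom K m - monom K m') = 0.
  rewrite def_mm' big_seq_cond; apply: (big_ind (fun p => phi p = 0)) => //.
    by move=> p p' hp hp'; rewrite phiD hp hp' addr0.
  by move=> c /andP[/sB [u Bu ->] _]; apply: phi_gen.
(* If [S m'] failed, this would read [1 - 0 = 0] in [K]. *)
move: phi_mm'; rewrite phiB !phiX -/(mexp _) -/(mexp _) => + Sm.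
have -> : T (mexp m) by apply/TP; rewrite vecK.
case: TP => [|_ /eqP]; first by rewrite vecK.
by rewrite subr0 oner_eq0.
Qed.

End Ideals.

(** * Markov moves, fibers and redundancy of a move *)

Definition upto_sign n (M : 'cV[int]_n -> Prop) (u : 'cV[int]_n) : Prop :=
  M u \/ M (- u).

Lemma upto_signN n (M : 'cV[int]_n -> Prop) u :
  upto_sign M u -> upto_sign M (- u).
Proof. by rewrite /upto_sign opprK => -[]; [right|left]. Qed.

Section Markov.
Variables (K : fieldType) (n : nat) (A : 'M[int]_(1, n)).
Hypothesis Apos : forall j, 0 < A 0 j.
Implicit Types (M B : 'cV[int]_n -> Prop) (m u v w z : 'cV[int]_n).

Lemma in_kerD u v : in_ker A u -> in_ker A v -> in_ker A (u + v).
Proof. by rewrite /in_ker mulmxDr => -> ->; rewrite addr0. Qed.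

Lemma in_kerN u : in_ker A u -> in_ker A (- u).
Proof. by rewrite /in_ker mulmxN => ->; rewrite oppr0. Qed.

Lemma markov_upto_sign_ker M u :
  markov_basis K A M -> upto_sign M u -> in_ker A u.
Proof. by move=> [MA _] [/MA//|/MA/in_kerN]; rewrite opprK. Qed.

Lemma in_ker_vpos_vneg u : in_ker A u -> A *m vpos u = A *m vneg u.
Proof.
by move=> Au; apply/subr0_eq; rewrite -mulmxBr vpos_sub_vneg.
Qed.

Definition wdeg v : int := (A *m v) 0 0.

Lemma wdegD v w : wdeg (v + w) = wdeg v + wdeg w.
Proof. by rewrite /wdeg mulmxDr mxE. Qed.

Lemma norm1_le_wdeg v : is_nat_vec v -> norm1 v <= wdeg v.
Proof.
move=> v0; rewrite /norm1 /wdeg mxE; apply: ler_sum => i _.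
rewrite ger0_norm ?v0 //.
by apply: ler_peMl; [exact: v0 | rewrite -gtz0_ge1 Apos].
Qed.

Lemma wdeg_ge0 v : is_nat_vec v -> 0 <= wdeg v.
Proof.
move=> v0; apply: le_trans (norm1_le_wdeg v0).
by apply: sumr_ge0 => i _; apply: normr_ge0.
Qed.

Lemma markov_monoms M m m' : markov_basis K A M ->
  is_nat_vec m -> is_nat_vec m' -> A *m m = A *m m' ->
  in_ideal K (binoms K M) (monom K m - monom K m').
Proof.
move=> [_ MI] m0 m'0 Am; apply/MI; pose u := m - m'.
have def_m : m = m' + u by rewrite addrC subrK.
have [|w] := @monom_sub_binom K _ m' u m'0; first by rewrite -def_m.
rewrite -def_m => ->.
apply: in_idealM; apply: in_ideal_gen; exists u => //.
by rewrite /in_ker mulmxBr Am subrr.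
Qed.

(** If no nonzero move applied at [m], the one-point class of [m] would be closed under the moves of
    [M], and its invariant would force [m' = m]. *)
Lemma markov_move M m m' : markov_basis K A M ->
  is_nat_vec m -> is_nat_vec m' -> A *m m = A *m m' -> m != m' ->
  exists2 u, upto_sign M u & u != 0 /\ is_nat_vec (m + u).
Proof.
move=> MA m0 m'0 Am /eqP nmm'; apply: NNPP => noMove; apply: nmm'.
apply/esym; apply: (@binoms_ideal_invariant K n M (fun v => v = m) (norm1 m + 1))
  (markov_monoms MA m0 m'0 Am) _ => //.
  by move=> v _ ->; rewrite ltrDl.
move=> u w Mu w0; have [u0|nu0] := eqVneq u 0.
  suff -> : vpos u = vneg u by [].
  by apply/subr0_eq; rewrite vpos_sub_vneg.
split=> def_m; case: noMove.
- exists (- u); first by right; rewrite opprK.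
  rewrite oppr_eq0; split=> //.
  suff -> : m - u = w + vneg u by apply: is_nat_vecD.
  by apply: colP => i; rewrite -def_m !colE; lia.
- exists u; first by left.
  split=> //; suff -> : m + u = w + vpos u by apply: is_nat_vecD.
  by apply: colP => i; rewrite -def_m !colE; lia.
Qed.

(** The monomials of the same degree as [m] and congruent to it modulo the low-degree binomials form
    a class closed under all of [B]: a move applied inside that degree has ends of degree at most
    [wdeg m]. *)
Lemma in_ideal_graded B m m' : (forall u, B u -> in_ker A u) ->
  is_nat_vec m -> is_nat_vec m' ->
  in_ideal K (binoms K B) (monom K m - monom K m') ->
  in_ideal K (binoms K (fun u => B u /\ wdeg (vpos u) <= wdeg m))
    (monom K m - monom K m').
Proof.
move=> BA m0 m'0 Bmm'; set J := in_ideal K _.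
pose S v := wdeg v = wdeg m /\ J (monom K m - monom K v).
suff [] : S m' by [].
have SBu u w : B u -> is_nat_vec w -> wdeg (w + vpos u) = wdeg m ->
    J (monom K (w + vpos u) - monom K (w + vneg u)).
  move=> Bu w0 wm; rewrite !monomD // -mulrBr; apply: in_idealM.
  apply: in_ideal_gen; exists u => //; split=> //.
  by rewrite -wm wdegD lerDr wdeg_ge0.
have deg_pn u : B u -> wdeg (vpos u) = wdeg (vneg u).
  by move=> /BA/in_ker_vpos_vneg Au; rewrite /wdeg Au.
apply: (@binoms_ideal_invariant K n B S (wdeg m + 1)) Bmm' _ => //.
- by move=> v v0 [<- _]; rewrite ltzD1 norm1_le_wdeg.
- move=> u w Bu w0; split=> -[wm Jm]; split.
  + by rewrite -wm !wdegD deg_pn.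
  + by have := in_idealD Jm (SBu u w Bu w0 wm); rewrite addrA subrK.
  + by rewrite -wm !wdegD deg_pn.
  + have := SBu u w Bu w0; rewrite wdegD deg_pn // -wdegD => /(_ wm)/in_idealN.
    by move/(in_idealD Jm); rewrite opprB addrA subrK.
- by split=> //; rewrite subrr; apply: in_ideal0.
Qed.

(** Paths avoiding [v] are encoded as ideal membership, so that transitivity is addition and
    translation is multiplication by a monomial. *)
Definition connected_without M v m m' : Prop :=
  in_ideal K (binoms K (fun u => M u /\ u <> v)) (monom K m - monom K m').

Lemma connected_without_refl M v m : connected_without M v m m.
Proof. by rewrite /connected_without subrr; apply: in_ideal0. Qed.

Lemma connected_without_sym M v m m' :
  connected_without M v m m' -> connected_without M v m' m.
Proof. by move/in_idealN; rewrite opprB. Qed.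

Lemma connected_without_trans M v m1 m2 m3 :
  connected_without M v m1 m2 -> connected_without M v m2 m3 ->
  connected_without M v m1 m3.
Proof. by move=> c12 /(in_idealD c12); rewrite addrA subrK. Qed.

Lemma minimal_markov_disconnected M v : minimal_markov_basis K A M -> M v ->
  ~ connected_without M v (vpos v) (vneg v).
Proof.
move=> [[MA MI] Mmin] Mv cv.
apply: (Mmin (fun u => M u /\ u <> v)) => [u []//||].
  by exists v => // -[].
split=> [u [/MA]//|p]; split=> [/(in_ideal_binoms_sub _)pM|/MI].
  by apply/MI; apply: pM => u [].
apply: in_ideal_trans => q [u Mu ->].
have [->|/eqP nuv] := eqVneq u v; first exact: cv.
by apply: in_ideal_gen; exists u.
Qed.

(** Both signs of [v] are excluded because the step [u] may come from [- u] in [M]. *)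
Lemma connected_without_step M v m u : upto_sign M u -> u != v -> u != - v ->
  is_nat_vec m -> is_nat_vec (m + u) -> connected_without M v m (m + u).
Proof.
move=> Mu /eqP nuv /eqP nuNv m0 mu0; apply: connected_without_sym.
have [w] := monom_sub_binom K m0 mu0; rewrite /connected_without => ->.
apply: in_idealM; case: Mu => Mu; first by apply: in_ideal_gen; exists u.
rewrite -[u]opprK binomN; apply: in_idealN; apply: in_ideal_gen.
by exists (- u) => //; split=> // uv; apply: nuNv; rewrite -uv opprK.
Qed.

(* Dividing by the common variable lowers the degree below that of [v], so [v]
   cannot contribute to the quotient binomial. *)
Lemma connected_without_common M v m m' l : markov_basis K A M ->
  is_nat_vec m -> is_nat_vec m' ->
  A *m m = A *m vpos v -> A *m m' = A *m vpos v ->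
  0 < m l 0 -> 0 < m' l 0 -> connected_without M v m m'.
Proof.
move=> MA m0 m'0 Am Am' ml m'l; pose e : 'cV[int]_n := delta_mx l 0.
have eE i : e i 0 = (i == l)%:R by rewrite mxE eqxx andbT.
have e0 : is_nat_vec e by move=> i; rewrite eE; case: eqP.
have sub0 x : is_nat_vec x -> 0 < x l 0 -> is_nat_vec (x - e).
  move=> x0 xl i; rewrite !colE eE; case: eqP => [->|_]; first lia.
  by rewrite subr0.
have mulE x : is_nat_vec (x - e) -> monom K x = monom K e * monom K (x - e).
  by move=> xe0; rewrite -monomD // addrC subrK.
have [me0 m'e0] := (sub0 _ m0 ml, sub0 _ m'0 m'l).
rewrite /connected_without (mulE m) // (mulE m') // -mulrBr; apply: in_idealM.
have := in_ideal_graded (proj1 MA) me0 m'e0.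
move/(_ (markov_monoms MA me0 m'e0 _)); rewrite !mulmxBr Am Am' => /(_ erefl).
apply: in_ideal_binoms_sub => u [Mu le_u]; split=> // uv.
suff e_gt0 : 0 < wdeg e.
  have : wdeg m = wdeg (vpos v) by rewrite /wdeg Am.
  have := wdegD (m - e) e; rewrite subrK; move: le_u; rewrite uv.
  by lia.
rewrite /wdeg mxE (bigD1 l) //= eE eqxx mulr1 big1 ?addr0 ?Apos // => i il.
by rewrite eE (negPf il) mulr0.
Qed.

End Markov.

(** * Distance reduction by signed moves *)

Section Reduction.
Variables (n : nat) (M : 'cV[int]_n -> Prop).
Implicit Types u w z : 'cV[int]_n.

Definition reduced z : Prop := exists2 u, M u & reduces_distance_of u z.

Lemma reduced_vposP z : reduced z <->
  exists2 w, upto_sign M w &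
    is_nat_vec (vpos z + w) /\ norm1 (z + w) < norm1 z \/
    is_nat_vec (vneg z + w) /\ norm1 (z - w) < norm1 z.
Proof.
have posE w : vpos z + w - vneg z = z + w by rewrite addrAC vpos_sub_vneg.
have negE w : norm1 (vneg z + w - vpos z) = norm1 (z - w).
  by apply: eq_bigr => i _; rewrite !colE; lia.
split=> [[u Mu [pq [eps [pqz [eps1 [nat_pq lt_pq]]]]]]|[w Mw zw]].
  exists (eps *: u).
    by case: eps1 => ->; [left|right]; rewrite ?scaleN1r ?opprK ?scale1r.
  by case: pqz nat_pq lt_pq => -> /=; [left; rewrite -posE|right; rewrite -negE].
have [u Mu [eps eps1 def_w]] : exists2 u, M u &
    exists2 eps : int, eps = 1 \/ eps = -1 & w = eps *: u.
  case: Mw => Mw; [exists w | exists (- w)] => //.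
    by exists 1; [left | rewrite scale1r].
  by exists (-1); [right | rewrite scaleN1r opprK].
exists u => //; case: zw => zw.
  by exists (vpos z, vneg z), eps; rewrite /= -def_w posE; intuition.
by exists (vneg z, vpos z), eps; rewrite /= -def_w negE; intuition.
Qed.

Lemma norm1N z : norm1 (- z) = norm1 z.
Proof. by apply: eq_bigr => i _; rewrite colN normrN. Qed.

Lemma reducedN z : reduced (- z) -> reduced z.
Proof.
move=> /reduced_vposP[w Mw]; rewrite vposN vnegN -opprD !norm1N => zw.
apply/reduced_vposP; exists w => //; case: zw => -[wz lt_w]; [right|left] => //.
by split=> //; rewrite -norm1N opprB addrC.
Qed.

End Reduction.

(** * Kernel vectors with a single negative coordinate *)

Section Rays.
Variables (K : fieldType) (n : nat) (A : 'M[int]_(1, n)).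
Hypothesis Apos : forall j, 0 < A 0 j.

Lemma in_ker_nat_eq0 (u : 'cV[int]_n) : in_ker A u -> is_nat_vec u -> u = 0.
Proof.
move=> Au u0; have := norm1_le_wdeg Apos u0; rewrite /wdeg Au mxE.
rewrite /norm1 => le_u; apply: colP => i; rewrite mxE.
apply/eqP; rewrite -normr_le0; apply: le_trans le_u.
by rewrite (bigD1 i) //= lerDl sumr_ge0.
Qed.

Definition ray l (y : 'cV[int]_n) : Prop :=
  [/\ in_ker A y, y l 0 < 0 & forall l', l' != l -> 0 <= y l' 0].

(** At the pure power [vneg y] a move can lower only coordinate [l], by at most [- y l 0]; a nonzero
    one does lower it, since a nonnegative kernel vector is zero. *)
Lemma markov_ray M l y : markov_basis K A M -> ray l y ->
  exists2 u, upto_sign M u & ray l u /\ y l 0 <= u l 0.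
Proof.
move=> MA [Ay yl y0].
have [||u Mu [nu0 mu0]] := markov_move MA (@vneg_nat _ y) (@vpos_nat _ y).
- by rewrite in_ker_vpos_vneg.
- apply/eqP => ypn; have := congr1 (fun v : 'cV__ => v l 0) ypn.
  by rewrite !colE; lia.
have Au := markov_upto_sign_ker MA Mu.
have u0 l' : l' != l -> 0 <= u l' 0.
  by move=> /y0; have := mu0 l'; rewrite !colE; lia.
exists u => //; split; last by have := mu0 l; rewrite !colE; lia.
split=> //; rewrite ltNge; apply: contraNN nu0 => ul.
by apply/eqP/in_ker_nat_eq0 => // l'; have [->|/u0] := eqVneq l' l.
Qed.

End Rays.

(** * Arithmetic and indices for three weights *)

Lemma add3_pos (a b c x y z : int) : 0 < a -> 0 < b -> 0 < c ->
  a * x + b * y + c * z = 0 -> y <= 0 -> z < 0 -> 0 < x.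
Proof. by nia. Qed.

Lemma add3_lt (a b c x y z : int) : 0 < a -> a < b -> a < c ->
  a * x + b * y + c * z = 0 -> x < 0 -> 0 <= y -> 0 <= z -> y + z < - x.
Proof.
move=> a0 ab ac e x0 y0 z0.
have : a * (x + y + z) = (a - b) * y + (a - c) * z by lia.
by nia.
Qed.

Definition distinct3 (i j k : 'I_3) := [&& i != j, i != k & j != k].

Lemma distinct3C i j k : distinct3 i j k -> distinct3 i k j.
Proof. by rewrite /distinct3 (eq_sym k) => /and3P[-> -> ->]. Qed.

Lemma distinct3_swap i j k : distinct3 i j k -> distinct3 j i k.
Proof. by rewrite /distinct3 (eq_sym j i) => /and3P[-> -> ->]. Qed.

Lemma distinct3_cover i j k : distinct3 i j k ->
  forall l, [\/ l = i, l = j | l = k].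
Proof.
move=> ijk l.
suff /or3P[] : [|| l == i, l == j | l == k] by move=> /eqP; constructor.
by move: i j k l ijk; do 4![case=> [[|[|[|//]]] ?]].
Qed.

Lemma big_distinct3 i j k (F : 'I_3 -> int) : distinct3 i j k ->
  \sum_l F l = F i + F j + F k.
Proof.
move=> ijk; case/and3P: (ijk) => ij ik jk.
rewrite (bigD1 i) // (bigD1 j) 1?eq_sym //= (bigD1 k) /=; last first.
  by rewrite !(eq_sym k) ik jk.
rewrite big1 ?addr0 ?addrA // => l.
by case: (distinct3_cover ijk l) => ->; rewrite eqxx ?andbF.
Qed.

(** * Reduction with three weights *)

Section Three.
Variables (K : fieldType) (A : 'M[int]_(1, 3)).
Hypothesis Apos : forall j, 0 < A 0 j.
Variable M : 'cV[int]_3 -> Prop.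
Hypothesis Mmin : minimal_markov_basis K A M.
Implicit Types (u v w y z : 'cV[int]_3) (i j k : 'I_3).

Let Mmarkov : markov_basis K A M := proj1 Mmin.

Lemma in_ker3 i j k z : distinct3 i j k ->
  in_ker A z <-> A 0 i * z i 0 + A 0 j * z j 0 + A 0 k * z k 0 = 0.
Proof.
move=> ijk; rewrite -(@big_distinct3 _ _ _ (fun l => A 0 l * z l 0) ijk).
split=> [Az|Az].
  by have := congr1 (fun v : 'M__ => v 0 0) Az; rewrite !mxE.
by apply/matrixP => r c; rewrite !ord1 !mxE.
Qed.

Lemma norm1_3 i j k z : distinct3 i j k ->
  norm1 z = `|z i 0| + `|z j 0| + `|z k 0|.
Proof. exact: big_distinct3. Qed.

Lemma is_nat_vec3 i j k z : distinct3 i j k ->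
  0 <= z i 0 -> 0 <= z j 0 -> 0 <= z k 0 -> is_nat_vec z.
Proof. by move=> ijk ? ? ? l; case: (distinct3_cover ijk l) => ->. Qed.

Lemma rayE i j k y : distinct3 i j k ->
  ray A i y <-> [/\ in_ker A y, y i 0 < 0, 0 <= y j 0 & 0 <= y k 0].
Proof.
move=> ijk; case/and3P: (ijk) => ij ik jk.
split=> [[Ay yi y0]|[Ay yi yj yk]]; first by split=> //; apply: y0; rewrite eq_sym.
by split=> // l; case: (distinct3_cover ijk l) => ->; rewrite ?eqxx.
Qed.

(** The move given by [markov_ray] for [- y] takes at most [y i 0] from coordinate [i], so it
    applies to [vpos z]; as [i] has the smallest weight, that coordinate loses more than the other
    two gain. *)
Lemma reduced_ray i j k y z :
  distinct3 i j k -> A 0 i < A 0 j -> A 0 i < A 0 k ->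
  in_ker A y -> 0 < y i 0 -> y j 0 <= 0 -> y k 0 <= 0 -> y i 0 <= z i 0 ->
  reduced M z.
Proof.
move=> ijk ij ik Ay yi yj yk yz.
have [|u Mu [/(rayE _ ijk)[Au ui uj uk]]] :=
  @markov_ray K _ A Apos M i (- y) Mmarkov.
  by apply/(rayE _ ijk); rewrite !colE; split; [exact: in_kerN|lia..].
rewrite colN => le_u; apply/reduced_vposP; exists u => //; left.
have lt_u := add3_lt (Apos i) ij ik (proj1 (in_ker3 _ ijk) Au) ui uj uk.
split; last by rewrite !(norm1_3 _ ijk) !colE; lia.
by apply: (is_nat_vec3 ijk); rewrite !colE; lia.
Qed.

(** For [w] on the [l]-ray, [- w l 0] is then the least positive multiplicity of the weight of [l]
    in the semigroup of the other weights. *)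
Definition minimal_ray l w := forall y, ray A l y -> y l 0 <= w l 0.

(** A nonzero kernel vector has entries of both signs, so among three coordinates one sign occurs
    only once; [caseI], [caseJ] and [caseK] treat the position of that entry. *)
Lemma reduced_of_minimal_ray i j k w z :
  distinct3 i j k -> A 0 i < A 0 j -> A 0 i < A 0 k ->
  upto_sign M w -> ray A j w -> minimal_ray j w -> w i 0 < w k 0 - w j 0 ->
  in_ker A z -> z != 0 -> reduced M z.
Proof.
move=> ijk ij ik Mw rw minw lt_w.
have jik := distinct3_swap ijk; have kij := distinct3_swap (distinct3C ijk).
have Ai := Apos i; have Aj := Apos j; have Ak := Apos k.
have [Aw wj wi wk] := proj1 (rayE _ jik) rw.
have caseJ x : ray A j x -> reduced M x.
  move=> rx; have le_w := minw _ rx.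
  have [Ax xj xi xk] := proj1 (rayE _ jik) rx.
  have Axw := in_kerD Ax (in_kerN Aw).
  (* If [w k 0 <= x k 0], subtracting [w] shortens coordinates [j] and [k] by more than it can
     lengthen [i]. Otherwise [x - w] is positive only at [i] and feeds [reduced_ray]. *)
  have [le_wk|lt_xk] := leP (w k 0) (x k 0).
    apply/reduced_vposP; exists w => //; right; split.
      by apply: (is_nat_vec3 ijk); rewrite !colE; lia.
    by rewrite !(norm1_3 _ ijk) !colE; lia.
  have /(add3_pos Ai Aj Ak) := proj1 (in_ker3 _ ijk) Axw; rewrite !colE => xwi.
  by apply: (reduced_ray ijk ij ik Axw); rewrite !colE; lia.
have caseK x : ray A k x -> reduced M x.
  move=> rx; have [u Mu [ru le_u]] := markov_ray Apos Mmarkov rx.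
  have [Ax xk xi xj] := proj1 (rayE _ kij) rx.
  have [Au uk ui uj] := proj1 (rayE _ kij) ru.
  have Axu := in_kerD Ax (in_kerN Au).
  have [le_uj|lt_xj] := leP (u j 0) (x j 0); last first.
    have /(in_ker3 _ (distinct3C ijk))/(add3_pos Ai Ak Aj) := Axu.
    rewrite !colE => xui.
    by apply: (reduced_ray ijk ij ik Axu); rewrite !colE; lia.
  have [le_ui|lt_xi] := leP (u i 0) (x i 0).
    apply/reduced_vposP; exists u => //; right; split.
      by apply: (is_nat_vec3 ijk); rewrite !colE; lia.
    by rewrite !(norm1_3 _ ijk) !colE; lia.
  (* In the remaining case minimality of [w] gives [- w j 0 <= x j 0], so [w] can be added to
     [vpos x]. *)
  have /minw : ray A j (u - x).
    have Aux : in_ker A (u - x) by rewrite -opprB; apply: in_kerN.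
    apply/(rayE _ jik); rewrite !colE; split; try lia; first exact: Aux.
    by have := proj1 (in_ker3 _ ijk) Aux; rewrite !colE; nia.
  rewrite !colE => le_uw; apply/reduced_vposP; exists w => //; left.
  (* Coordinates [i] and [j] of [x + w] are nonnegative, so adding [w] cannot overshoot zero at
     [k]. *)
  have xwk : x k 0 + w k 0 <= 0.
    by have := proj1 (in_ker3 _ ijk) (in_kerD Ax Aw); rewrite !colE; nia.
  split; first by apply: (is_nat_vec3 ijk); rewrite !colE; lia.
  by rewrite !(norm1_3 _ ijk) !colE; lia.
have caseI x : in_ker A x -> 0 < x i 0 -> x j 0 <= 0 -> x k 0 <= 0 -> reduced M x.
  by move=> Ax *; apply: (reduced_ray ijk ij ik Ax).
move=> Az nz0; have ANz := in_kerN Az; have Ez := proj1 (in_ker3 _ ijk) Az.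
have nz : z i 0 != 0 \/ z j 0 != 0 \/ z k 0 != 0.
  apply: NNPP => z0; case/eqP: nz0; apply: colP => l; rewrite mxE.
  by case: (distinct3_cover ijk l) => ->; lia.
have [] : [\/ 0 < z i 0 /\ z j 0 <= 0 /\ z k 0 <= 0,
    0 < - z i 0 /\ - z j 0 <= 0 /\ - z k 0 <= 0 |
    [\/ z j 0 < 0 /\ 0 <= z i 0 /\ 0 <= z k 0,
       - z j 0 < 0 /\ 0 <= - z i 0 /\ 0 <= - z k 0,
      z k 0 < 0 /\ 0 <= z i 0 /\ 0 <= z j 0 |
      - z k 0 < 0 /\ 0 <= - z i 0 /\ 0 <= - z j 0]].
- case: (ltgtP (z i 0) 0) => zi; case: (ltgtP (z j 0) 0) => zj;
  case: (ltgtP (z k 0) 0) => zk; try (exfalso; nia);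
  by first [apply: Or31; lia | apply: Or32; lia
    | apply: Or33; first [apply: Or41; lia | apply: Or42; lia
                         | apply: Or43; lia | apply: Or44; lia]].
- by case=> ? [? ?]; apply: caseI.
- by case=> ? [? ?]; apply: reducedN; apply: caseI; rewrite ?colN.
- case=> -[? [? ?]].
  + by apply: caseJ; apply/(rayE _ jik).
  + by apply: reducedN; apply: caseJ; apply/(rayE _ jik); rewrite !colN.
  + by apply: caseK; apply/(rayE _ kij).
  + by apply: reducedN; apply: caseK; apply/(rayE _ kij); rewrite !colN.
Qed.

(* If a smaller element of [M] on the [j]-ray existed, replacing [w] by it would
   connect both ends of [w] through a common variable, so [w] would be redundant;
   the only escape is that [w] is also a minimal element of the [k]-ray. *)
Lemma minimal_ray_of_lt i j k w :
  distinct3 i j k -> A 0 i < A 0 j -> upto_sign M w -> ray A j w ->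
  w i 0 < w k 0 - w j 0 ->
  minimal_ray j w \/ [/\ w i 0 = 0, 0 < w k 0 & minimal_ray k (- w)].
Proof.
move=> ijk ij Mw rw lt_w.
have jik := distinct3_swap ijk; have kij := distinct3_swap (distinct3C ijk).
have Ai := Apos i; have Aj := Apos j; have Ak := Apos k.
have [Aw wj wi wk] := proj1 (rayE _ jik) rw.
have Ew := proj1 (in_ker3 _ ijk) Aw.
have [|nmin] := classic (minimal_ray j w); [by left | right].
have [y ry lt_y] : exists2 y, ray A j y & w j 0 < y j 0.
  apply: NNPP => noy; apply: nmin => y ry; rewrite leNgt; apply/negP => lt_y.
  by apply: noy; exists y.
have [u Mu [/(rayE _ jik)[Au uj ui uk] le_u]] := markov_ray Apos Mmarkov ry.
have Eu := proj1 (in_ker3 _ ijk) Au.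
have [v [Mv wv]] : exists v, M v /\ (w = v \/ w = - v).
  by case: Mw => Mw; [exists w | exists (- w); rewrite opprK]; intuition.
have Awpn := in_ker_vpos_vneg Aw.
have Awv : A *m vpos w = A *m vpos v.
  by case: wv Awpn => ->; rewrite // vposN vnegN.
have disc : ~ connected_without K M v (vneg w) (vpos w).
  move=> cw; apply: (minimal_markov_disconnected Mmin Mv).
  case: wv cw => ->; last by rewrite vposN vnegN.
  exact: connected_without_sym.
have neq_v (x : 'cV[int]_3) l : x l 0 != w l 0 -> x l 0 != - w l 0 -> x != v /\ x != - v.
  by case: wv => ->; rewrite ?colN ?opprK => xl xl'; split;
     apply/eqP => xv; move: xl xl'; rewrite xv ?colN eqxx.
have AD (m x : 'cV[int]_3) : in_ker A x -> A *m m = A *m vpos v -> A *m (m + x) = A *m vpos v.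
  by move=> Ax <-; rewrite mulmxDr Ax addr0.
(* [u] removes less of [j] than [w] does, so [u] is neither [v] nor [- v], and [f] still involves
   [j]. *)
pose f := vneg w + u.
have f0 : is_nat_vec f by apply: (is_nat_vec3 ijk); rewrite !colE; lia.
have Af : A *m f = A *m vpos v by apply: AD; rewrite -?Awpn.
have cf : connected_without K M v (vneg w) f.
  have [||? ?] := @neq_v u j; try by apply/eqP; lia.
  exact: connected_without_step.
have ndf l : ~ (0 < f l 0 /\ 0 < vpos w l 0).
  move=> [fl wl]; apply: disc; apply: connected_without_trans cf _.
  exact: (connected_without_common Apos Mmarkov (l := l)).
(* If [w k 0] vanished, the smaller weight at [i] would force [w i 0] above [- w j 0], against
   [lt_w]. *)
have wk0 : 0 < w k 0 by nia.
(* As [f] and [vpos w] share no variable, [u] misses [k], hence uses [i], and then [w] misses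
   [i]. *)
have uk0 : u k 0 = 0 by have := ndf k; rewrite !colE; lia.
have ui0 : 0 < u i 0 by nia.
have wi0 : w i 0 = 0 by have := ndf i; rewrite !colE; lia.
split=> // y' ry'; rewrite colN leNgt; apply/negP => lt_y'.
have [u' Mu' [/(rayE _ kij)[Au' u'k u'i u'j] le_u']] :=
  markov_ray Apos Mmarkov ry'.
have Eu' := proj1 (in_ker3 _ ijk) Au'.
(* This mirrors [f] at the other end of [w]. Comparing [g] with [vneg w] excludes [j] from [u'], so
   [u'] uses [i], which [f] uses too. *)
pose g := vpos w + u'.
have g0 : is_nat_vec g by apply: (is_nat_vec3 ijk); rewrite !colE; lia.
have Ag : A *m g = A *m vpos v by apply: AD.
have cg : connected_without K M v (vpos w) g.
  have [||? ?] := @neq_v u' k; try by apply/eqP; lia.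
  exact: connected_without_step.
have ndg (m : 'cV[int]_3) l : is_nat_vec m -> A *m m = A *m vpos v ->
    connected_without K M v (vneg w) m -> ~ (0 < m l 0 /\ 0 < g l 0).
  move=> m0 Am cm [ml gl]; apply: disc; apply: connected_without_trans cm _.
  apply: connected_without_trans (connected_without_sym cg).
  exact: (connected_without_common Apos Mmarkov (l := l)).
have u'j0 : u' j 0 = 0.
  have := ndg (vneg w) j (@vneg_nat _ w); rewrite -Awpn !colE.
  by move=> /(_ Awv (connected_without_refl _ _ _ _)); lia.
have u'i0 : 0 < u' i 0 by nia.
by have := ndg f i f0 Af cf; rewrite !colE; lia.
Qed.

(** A reducing move is added to one of the two pure powers of the circuit, so it is negative at the
    index of that power and nowhere else. *)
Lemma reduced_circuit_ray i j k : distinct3 i j k ->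
  reduces_distance_set M (circuit A) ->
  exists2 w, upto_sign M w &
    ray A j w /\ w i 0 < w k 0 - w j 0 \/ ray A k w /\ w i 0 < w j 0 - w k 0.
Proof.
move=> ijk redM; case/and3P: (ijk) => ij ik jk.
have jik := distinct3_swap ijk; have kij := distinct3_swap (distinct3C ijk).
have Ai := Apos i; have Aj := Apos j; have Ak := Apos k.
pose z : 'cV[int]_3 :=
  \col_l if l == j then A 0 k else if l == k then - A 0 j else 0.
have zi : z i 0 = 0 by rewrite mxE (negPf ij) (negPf ik).
have zj : z j 0 = A 0 k by rewrite mxE eqxx.
have zk : z k 0 = - A 0 j by rewrite mxE eq_sym (negPf jk) eqxx.
have nz0 : z != 0.
  by apply/eqP => z0; have := zj; rewrite z0 mxE; lia.
have Cz : circuit A z.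
  split; first by apply/(in_ker3 _ ijk); rewrite zi zj zk; lia.
  split=> //; have -> : [set l | z l 0 != 0] = [set j; k].
    apply/setP => l; rewrite !inE.
    by case: (distinct3_cover ijk l) => ->; rewrite ?zi ?zj ?zk ?eqxx;
       rewrite ?(negPf ij) ?(negPf ik) ?orbT; lia.
  by rewrite cards2 jk.
have /reduced_vposP[w Mw zw] := redM z Cz nz0.
have Aw := markov_upto_sign_ker Mmarkov Mw; have Ew := proj1 (in_ker3 _ ijk) Aw.
exists w => //; case: zw => -[w0]; rewrite !(norm1_3 _ ijk) !colE zi zj zk => lt_w;
  move: (w0 i) (w0 j) (w0 k); rewrite !colE zi zj zk => wi wj wk; [left|right].
- have wj0 : w j 0 < 0 by rewrite ltNge; apply/negP => wj0; nia.
  split; last by lia.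
  by apply/(rayE _ jik); split=> //; lia.
- have wk0 : w k 0 < 0 by rewrite ltNge; apply/negP => wk0; nia.
  split; last by lia.
  by apply/(rayE _ kij); split=> //; lia.
Qed.

End Three.

(** * The smallest weight and the equivalence *)

Lemma exists_min3 (a : 'I_3 -> int) : (forall j k, j != k -> a j != a k) ->
  exists i j k, [/\ distinct3 i j k, a i < a j & a i < a k].
Proof.
move=> inj_a; pose i := [arg min_(l < (0 : 'I_3)) a l]%O.
have min_i l : a i <= a l by rewrite /i; case: arg_minP => // m _; apply.
have lt_i l : i != l -> a i < a l by move=> il; rewrite lt_neqAle inj_a ?min_i.
have ijk : distinct3 i (i + 1) (i + 1 + 1).
  by clearbody i; case: i {min_i lt_i} => [[|[|[|//]]] ?].
(* Addition in ['I_3] is modulo 3, which yields the other two indices. *)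
exists i, (i + 1), (i + 1 + 1).
by case/and3P: (ijk) => /lt_i ? /lt_i ? _.
Qed.

Theorem theorem3p1 (K : fieldType) (A : 'M[int]_(1, 3))
    (Hpos : forall j, 0 < A 0 j)
    (Hdist : forall j k, j != k -> A 0 j != A 0 k)
    (M : 'cV[int]_3 -> Prop)
    (HM : minimal_markov_basis K A M) :
  distance_reducing A M <-> reduces_distance_set M (circuit A).
Proof.
split=> [redM z [Az _]|redC z Az nz0]; first exact: redM.
have [i [j [k [ijk ij ik]]]] := exists_min3 Hdist.
have key j' k' w : distinct3 i j' k' -> A 0 i < A 0 j' -> A 0 i < A 0 k' ->
    upto_sign M w -> ray A j' w -> w i 0 < w k' 0 - w j' 0 -> reduced M z.
  move=> ijk' ij' ik' Mw rw lt_w.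
  have [minw|[wi wk minw]] := minimal_ray_of_lt Hpos HM ijk' ij' Mw rw lt_w.
    exact: (reduced_of_minimal_ray Hpos HM ijk' ij' ik' Mw rw minw lt_w).
  have [Aw wj _] := rw.
  (* Here [w] vanishes at [i], so [- w] lies on the [k']-ray and satisfies the inequality with [j']
     and [k'] exchanged. *)
  apply: (reduced_of_minimal_ray Hpos HM (distinct3C ijk') ik' ij'
            (upto_signN Mw) _ minw) => //; last by rewrite !colN; lia.
  split; [exact: in_kerN | by rewrite colN oppr_lt0 |].
  move=> l lk; rewrite colN.
  by case: (distinct3_cover ijk' l) lk => ->; rewrite ?eqxx // => _; lia.
have [w Mw [] [rw lt_w]] := reduced_circuit_ray Hpos HM ijk redC.
  exact: (key j k w).
exact: (key k j w (distinct3C ijk)).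
Qed.
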